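(* Let $q$ be a prime power, $b\in\mathbb F_q[T]$ of degree $m\ge1$, and $\ell\ge1$. Then \[\frac{1}{q^{m\ell}}\sum_{\substack{f\in\mathbb F_q[T]\\ \deg f<m\ell}}\mathrm{Trun}^L_{q,b}(f) = (q-1) \sum_{t=1}^m q^{-t} \sum_{\substack{1 \le h < m \ell \\ h \equiv -t \pmod m}} \frac 1h + E,\] where $E\ll \frac1q$ as $q\to\infty$ or as $\ell\to\infty$, and $E\ll \frac{q\log^2(m\ell)}{q^{m/2}}$ as $m\to\infty$.
   Context: For $f\in\mathbb F_q[T]$, $\mathrm{Trun}^L_{q,b}(f)$ is the number of irreducible (not necessarily monic) polynomials $g\in\mathbb F_q[T]$ with $\deg g\le \deg f$ and $g\equiv f \pmod{b^{\lfloor \deg(g)/m\rfloor+1}}$ (i.e. the irreducible base-$b$ truncations of $f$). Implied constants are independent of $q,m,\ell$. *)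

(* Defs.v *)
From HB Require Import structures.
From mathcomp Require Export all_boot all_order all_algebra.
From mathcomp Require Export qpoly.
From mathcomp Require Export boolp reals exp.

Set Implicit Arguments.
Unset Strict Implicit.
Unset Printing Implicit Defensive.

Import Order.TTheory GRing.Theory Num.Theory.
Local Open Scope ring_scope.

(* [size p] is [deg p + 1], so [(size p).-1] is the degree of a nonzero [p].
   Letting [g] range over [{poly_(size f) F}], the polynomials with
   [size g <= size f], expresses [deg g <= deg f]; this includes [f = 0]
   (degree minus infinity), where the only candidate is [g = 0].
   [irreducible_poly] excludes constants and does not require monicity. *)
Definition trunL (F : finFieldType) (b f : {poly F}) : nat :=
  #|[set g : {poly_(size f) F} |
      `[< irreducible_poly (g : {poly F}) >] &&
      (b ^+ ((size (g : {poly F})).-1 %/ (size b).-1).+1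
         %| (g : {poly F}) - f)]|.

(* Main.v *)
Require Import Defs.
From mathcomp Require Import finfield qfpoly separable.
From mathcomp Require Import zify ring lra.

(** An irreducible [g] of degree [h] is a truncation of exactly
    [q ^ (m * l - m * (h %/ m).+1)] polynomials [f] of degree less than [m * l]:
    those of the form [g + b ^+ (h %/ m).+1 * c], for which [deg g <= deg f] is
    automatic because [b ^+ (h %/ m).+1] has degree greater than [h].  So with
    [t = m * (h %/ m).+1 - h] and [pi h] the number of monic irreducible
    polynomials of degree [h], the average equals
    [(q - 1) * \sum_h q ^- t * (pi h / q ^+ h)] exactly, and the error only comes
    from replacing [pi h] by [q ^+ h / h].  Factoring the separable polynomial
    ['X^(q ^ h) - 'X] into the irreducible polynomials of degree dividing [h]
    gives [q ^ h - 2 * q ^ h./2 <= h * pi h <= q ^ h].  Hence the error is at most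
    [(q - 1) * \sum_h 2 * q ^ (- t - uphalf h) / h].  Since [1 <= t], this is
    [O(1 / q)]; since [m <= 2 * (t + uphalf h)], it is also
    [O(q * ln (m * l) / q `^ (m / 2))]. *)

Set Implicit Arguments.
Unset Strict Implicit.
Unset Printing Implicit Defensive.

Import Order.TTheory GRing.Theory Num.Theory.
Local Open Scope ring_scope.

(** * Divisibility of polynomials and irreducible factors *)

Lemma dvdp_comp_poly_sub (R : idomainType) (p u v : {poly R}) :
  u - v %| (p \Po u) - (p \Po v).
Proof.
elim/poly_ind: p => [|p c IHp]; first by rewrite !comp_poly0 subrr dvdp0.
rewrite !comp_polyD !comp_polyM !comp_polyX !comp_polyC.
have -> : (p \Po u) * u + c%:P - ((p \Po v) * v + c%:P) =
    (p \Po u) * (u - v) + ((p \Po u) - (p \Po v)) * v.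
  by rewrite mulrBr mulrBl opprD addrACA subrr addr0 addrA subrK.
by apply: dvdp_add; [apply: dvdp_mull | apply: dvdp_mulr].
Qed.

(** Non-associate irreducible polynomials are coprime, so Gauss's lemma splits the factors off one
    at a time. *)
Lemma dvdp_prod_irreducible (F : fieldType) (I : finType) (S : {set I})
    (P : I -> {poly F}) (f : {poly F}) :
    {in S, forall i, irreducible_poly (P i)} ->
    {in S &, forall i j, P i %= P j -> i = j} ->
    {in S, forall i, P i %| f} ->
  \prod_(i in S) P i %| f.
Proof.
move=> irrP injP dvdP; rewrite -big_enum /=.
have : {subset enum S <= S} by move=> i; rewrite mem_enum.
elim: (enum S) (enum_uniq S) => [|i s IHs] /=; first by rewrite big_nil dvd1p.
case/andP=> iNs us sS; rewrite big_cons.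
have Si : i \in S by rewrite sS ?mem_head.
have sS' : {subset s <= S} by move=> j js; rewrite sS // inE js orbT.
rewrite Gauss_dvdp ?dvdP ?IHs //.
(* It remains to see that [P i] is coprime to the product over the rest of the list. *)
elim: s iNs sS' {IHs us sS} => [|j s IHs] /=.
  by rewrite big_nil coprimep1.
rewrite inE negb_or big_cons => /andP[ij iNs] sS.
rewrite coprimepMr IHs ?andbT //; last by move=> k ks; rewrite sS // inE ks orbT.
have Sj : j \in S by rewrite sS ?mem_head.
rewrite irreducible_poly_coprime; last exact: irrP.
apply: contra ij => ijd; apply/eqP/injP => //.
by apply: (irrP j Sj).2 => //; rewrite neq_ltn (irrP i Si).1 orbT.
Qed.

Lemma irreducible_polyZ (F : fieldType) (c : F) (p : {poly F}) :
  c != 0 -> irreducible_poly p -> irreducible_poly (c *: p).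
Proof.
move=> c0 irr; split=> [|d d1]; first by rewrite size_scale // irr.1.
rewrite dvdpZr // => /irr -/(_ d1) /eqp_trans-> //.
by rewrite eqp_sym eqp_scale.
Qed.

Lemma size_Xn_subX (R : nzRingType) n : (1 < n)%N ->
  size ('X^n - 'X : {poly R}) = n.+1.
Proof. by move=> n1; rewrite size_polyDl size_polyXn // size_polyN size_polyX. Qed.

(** Descent on the size: a reducible [f] has a nonconstant divisor of smaller size. *)
Lemma monic_irreducible_divisor (F : fieldType) (f : {poly F}) :
  (1 < size f)%N -> exists2 p, p %| f & monic_irreducible_poly p.
Proof.
have [n] := ubnP (size f); elim: n f => // n IHn f /ltnSE lfn f1.
have f0 : f != 0 by rewrite -size_poly_gt0 ltnW.
have lf0 : lead_coef f != 0 by rewrite lead_coef_eq0.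
have [irr | nirr] := pselect (irreducible_poly f).
  exists ((lead_coef f)^-1 *: f); first by rewrite dvdpZl ?invr_eq0.
  split; last by rewrite monicE lead_coefZ mulVf.
  by apply: irreducible_polyZ; rewrite ?invr_eq0.
have [d [d1 df dNf]] :
    exists d : {poly F}, [/\ size d != 1%N, d %| f & ~~ (d %= f)].
  apply: contrapT => H; apply: nirr; split=> // d d1 df.
  by apply: contrapT => /negP dNf; apply: H; exists d.
have d0 : d != 0 by apply: contraTneq df => ->; rewrite dvd0p.
have [||p pd mip] := IHn d.
- apply: leq_trans lfn; rewrite ltn_neqAle dvdp_leq // andbT.
  by rewrite dvdp_size_eqp.
- by rewrite ltn_neqAle eq_sym d1 size_poly_gt0.
by exists p => //; apply: dvdp_trans df.
Qed.

(** * Irreducible divisors of ['X^(q ^ n) - 'X] *)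

Section FiniteField.
Variable F : finFieldType.
Local Notation q := #|F|.

Let q_gt1 : (1 < q)%N. Proof. exact: finNzRing_gt1. Qed.

Lemma pchar_nat_card n : [pchar {poly F}].-nat (q ^ n)%N.
Proof.
have [p pr_p chp] := finPcharP F.
have chp' : p \in [pchar {poly F}] by rewrite pchar_poly.
rewrite (eq_pnat _ (pcharf_eq chp')) pnatX.
rewrite (card_pprimeChar chp) pnatX pnat_id //.
Qed.

(** Raising to the power [q ^ n] is additive, [q] being a power of the characteristic, and fixes the
    coefficients, which lie in [F]. *)
Lemma poly_exp_card (g : {poly F}) n : g ^+ (q ^ n) = g \Po 'X^(q ^ n).
Proof.
elim/poly_ind: g => [|g c IHg].
  by rewrite comp_poly0 expr0n expn_eq0 -[q == 0%N]leqn0 leqNgt ltnW.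
rewrite comp_polyD comp_polyM comp_polyX comp_polyC.
rewrite exprDn_pchar ?pchar_nat_card //.
rewrite exprMn IHg -polyC_exp; congr (_ + _%:P).
by elim: n {IHg} => [|n IHn]; rewrite ?expn0 ?expr1 // expnSr exprM IHn expf_card.
Qed.

(** The difference is [g] composed with ['X^(q ^ n)] minus [g] composed with ['X], hence a multiple
    of ['X^(q ^ n) - 'X]. *)
Lemma dvdp_exp_card_sub (p g : {poly F}) n :
  p %| 'X^(q ^ n) - 'X -> p %| g ^+ (q ^ n) - g.
Proof.
move=> /dvdp_trans; apply; rewrite poly_exp_card.
by have := dvdp_comp_poly_sub g 'X^(q ^ n) 'X; rewrite comp_polyXr.
Qed.

Section Quotient.
Variables (p : {poly F}) (mip : monic_irreducible_poly p).

Lemma in_qpoly_eq0 g : (in_qpoly p g == 0) = (p %| g).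
Proof.
by rewrite -val_eqE /= mk_monicE // -Pdiv.IdomainMonic.modpE ?mip.
Qed.

(** The quotient by [p] is a field [K] with [q ^ (size p).-1] elements, and [y ^+ #|K| = y] holds
    there, in particular for the class of ['X]. *)
Lemma irreducible_dvdp_Xqn : p %| 'X^(q ^ (size p).-1) - 'X.
Proof.
rewrite -in_qpoly_eq0 rmorphB rmorphXn /= subr_eq0 -(card_qfpoly mip).
by apply/eqP; apply: (@expf_card {poly %/ p with mip}).
Qed.

(* Every element of the field F[X]/(p), which has q^d elements, is fixed by
   y |-> y^(q^n) and by y |-> y^(q^d), hence is a root of X^(q^r) - X, where r is
   the remainder of n modulo d; this polynomial has too few roots if r != 0. *)
Lemma irreducible_dvdp_Xqn_dvdn n :
  p %| 'X^(q ^ n) - 'X -> ((size p).-1 %| n)%N.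
Proof.
move=> pdvd; set d := (size p).-1.
pose K : finFieldType := {poly %/ p with mip}.
have cK : #|K| = (q ^ d)%N by exact: card_qfpoly.
have d0 : (0 < d)%N by rewrite /d -subn1 subn_gt0; case: mip => -[].
have Kn (y : K) : y ^+ (q ^ n) = y.
  have /eqP : in_qpoly p ((y : {poly F}) ^+ (q ^ n) - (y : {poly F})) = 0.
    by apply/eqP; rewrite in_qpoly_eq0 dvdp_exp_card_sub.
  rewrite rmorphB rmorphXn /= subr_eq0.
  have -> : in_qpoly p (y : {poly F}) = y.
    exact/val_inj/in_qpoly_small/size_mk_monic.
  by move/eqP.
have Kd (y : K) i : y ^+ (q ^ (i * d)) = y.
  elim: i => [|i IHi]; first by rewrite mul0n expr1.
  by rewrite mulSn expnD exprM -cK expf_card.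
apply: contraT => /negbTE; rewrite /dvdn; set r := (n %% d)%N => /negbT.
rewrite -lt0n => r0; have rd : (r < d)%N by rewrite ltn_mod.
have Kr (y : K) : y ^+ (q ^ r) = y.
  by rewrite -[RHS]Kn (divn_eq n d) expnD exprM Kd.
pose f : {poly K} := 'X^(q ^ r) - 'X.
have sf : size f = (q ^ r).+1.
  by apply: size_Xn_subX; rewrite -(ltn_exp2l 0 r q_gt1) in r0.
have : (size (enum K) < size f)%N.
  apply: max_poly_roots; rewrite ?enum_uniq //; first by rewrite -size_poly_gt0 sf.
  by apply/allP=> y _; rewrite rootE !hornerE Kr subrr.
by rewrite -cardE cK sf ltnS leq_exp2l // leqNgt rd.
Qed.

End Quotient.
End FiniteField.

(* [{poly_N F}] only provides a finite ambient type: the cardinal of [irr_polys]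
   does not depend on [N] as long as [n < N]. *)
Definition irr_polys (F : finFieldType) (N n : nat) :=
  [set g : {poly_N F} |
    `[< irreducible_poly (g : {poly F}) >] && (size g == n.+1)].

Definition monic_irr_polys (F : finFieldType) (N n : nat) :=
  [set g in irr_polys F N n | (g : {poly F}) \is monic].

(** A proper divisor of [n] is at most [n./2], and a geometric sum of ratio at least 2 is at most
    twice its last term. *)
Lemma sum_dvdn_exp_le (q n : nat) : (1 < q)%N ->
  (\sum_(0 <= d < n | d %| n) q ^ d <= 2 * q ^ n./2)%N.
Proof.
move=> q1; have sumX k : (\sum_(0 <= d < k.+1) q ^ d <= 2 * q ^ k)%N.
  elim: k => [|k IHk]; first by rewrite big_nat1 expn0.
  rewrite big_nat_recr //= (leq_trans (leq_add IHk (leqnn _))) //.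
  by rewrite (mul2n (_ ^ k.+1)) -addnn leq_add2r expnS leq_mul2r q1 orbT.
apply: leq_trans (sumX n./2); case: n => [|n]; first by rewrite big_geq.
rewrite big_mkcond (@big_cat_nat _ _ _ n.+1./2.+1) //=; last first.
  by rewrite ltnS uphalf_half; lia.
rewrite [X in (_ + X)%N]big1_seq ?addn0; last first.
  move=> d /=; rewrite mem_index_iota => /andP[nd dn].
  case: ifP => // /dvdnP[[|[|k]]]; lia.
by apply: leq_sum => d _; case: ifP.
Qed.

(** * Counting irreducible polynomials of a given degree *)

Section Counting.
Variables (F : finFieldType) (N : nat).
Local Notation q := #|F|.
Local Notation mirr := (monic_irr_polys F N).

Let q_gt1 : (1 < q)%N. Proof. exact: finNzRing_gt1. Qed.

Lemma monic_irr_polysP n (g : {poly_N F}) :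
  reflect (monic_irreducible_poly (g : {poly F}) /\ size g = n.+1)
          (g \in mirr n).
Proof.
rewrite !inE; apply: (iffP andP) => [[/andP[/asboolP ? /eqP ?] ?]|].
  by split.
by case=> -[? ?] ->; split=> //; rewrite eqxx andbT; apply/asboolP.
Qed.

Lemma size_Xqn_sub n : (0 < n)%N ->
  size ('X^(q ^ n) - 'X : {poly F}) = (q ^ n).+1.
Proof.
by move=> n0; apply: size_Xn_subX; rewrite -(ltn_exp2l 0 n q_gt1) in n0.
Qed.

Lemma size_prod_npoly (S : {set {poly_N F}}) :
    {in S, forall p : {poly_N F}, (p : {poly F}) != 0} ->
  (size (\prod_(p in S) (p : {poly F}))).-1 = (\sum_(p in S) (size p).-1)%N.
Proof.
move=> S0; rewrite size_prod //= subSn /=; last first.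
  by rewrite -sum1_card leq_sum // => p /S0; rewrite size_poly_gt0.
rewrite -sum1_card -sumnB /=; last by move=> p /S0; rewrite size_poly_gt0.
by apply: eq_bigr => p _; rewrite subn1.
Qed.

Lemma monic_eqp_inj (S : {set {poly_N F}}) :
    {in S, forall p : {poly_N F}, (p : {poly F}) \is monic} ->
  {in S &, forall p r : {poly_N F}, (p : {poly F}) %= r -> p = r}.
Proof.
move=> Sm p r /Sm pm /Sm rm; rewrite eqp_monic // => /eqP; exact: val_inj.
Qed.

(** For [n > 0], the product of these pairwise coprime polynomials divides ['X^(q ^ n) - 'X];
    compare degrees. *)
Lemma card_monic_irr_le n : (n * #|mirr n| <= q ^ n)%N.
Proof.
case: n => [|n]; first by rewrite mul0n.
have mi p : p \in mirr n.+1 -> monic_irreducible_poly (p : {poly F}).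
  by case/monic_irr_polysP.
have : \prod_(p in mirr n.+1) (p : {poly F}) %| 'X^(q ^ n.+1) - 'X.
  apply: dvdp_prod_irreducible => [p /mi[] //||p].
    by apply: monic_eqp_inj => p /mi[].
  by case/monic_irr_polysP=> mip sp; have := irreducible_dvdp_Xqn mip; rewrite sp.
move/dvdp_leq; rewrite -size_poly_gt0 size_Xqn_sub // => /(_ isT).
rewrite -[X in (_ <= X)%N]add1n -leq_subLR subn1 size_prod_npoly; last first.
  by move=> p /mi[/irredp_neq0].
rewrite (eq_bigr (fun=> n.+1)) ?sum_nat_const 1?mulnC // => p.
by case/monic_irr_polysP=> _ ->.
Qed.

(** The derivative is [-1], since the characteristic divides [q ^ n]. *)
Lemma separable_Xqn_sub n : (0 < n)%N ->
  separable_poly ('X^(q ^ n) - 'X : {poly F}).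
Proof.
move=> n0; rewrite unlock derivB derivXn derivX.
have -> : 'X^((q ^ n).-1) *+ (q ^ n) = 0 :> {poly F}.
  rewrite -mulr_natr.
  have [p pr_p chp] := finPcharP F.
  suff -> : (q ^ n)%:R = 0 :> {poly F} by rewrite mulr0.
  have chp' : p \in [pchar {poly F}] by rewrite pchar_poly.
  apply/eqP; rewrite -(dvdn_pcharf chp') Euclid_dvdX // n0 andbT.
  rewrite (card_pprimeChar chp) Euclid_dvdX // dvdnn /=.
  by rewrite lt0n; apply: contraTneq q_gt1 => l0; rewrite (card_pprimeChar chp) l0.
by rewrite sub0r -(scaleN1r 1) coprimepZr ?coprimep1 // oppr_eq0 oner_eq0.
Qed.

(** By separability ['X^(q ^ n) - 'X] has the same degree as the product of its monic irreducible
    divisors, whose degrees all divide [n]. *)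
Lemma exp_card_le_sum_monic_irr n : (0 < n < N)%N ->
  (q ^ n <= \sum_(d < n.+1 | d %| n) d * #|mirr d|)%N.
Proof.
case/andP=> n0 nN.
pose f : {poly F} := 'X^(q ^ n) - 'X.
have sf : size f = (q ^ n).+1 by rewrite size_Xqn_sub.
have f0 : f != 0 by rewrite -size_poly_gt0 sf.
pose S := [set p : {poly_N F} | `[< irreducible_poly (p : {poly F}) >] &&
             ((p : {poly F}) \is monic) && ((p : {poly F}) %| f)].
have SP (p : {poly_N F}) :
    reflect (monic_irreducible_poly (p : {poly F}) /\ (p : {poly F}) %| f)
            (p \in S).
  rewrite inE; apply: (iffP andP) => [[/andP[/asboolP ? ?] ?]|[[? ->] ?]] //.
  by split=> //; rewrite andbT; apply/asboolP.
set Q := \prod_(p in S) (p : {poly F}).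
have Qf : Q %| f.
  apply: dvdp_prod_irreducible => [p /SP[[]] //||p /SP[] //].
  by apply: monic_eqp_inj => p /SP[[]].
have degS (p : {poly_N F}) :
    p \in S -> (0 < (size p).-1 < n.+1)%N && ((size p).-1 %| n)%N.
  case/SP=> mip /(irreducible_dvdp_Xqn_dvdn mip) dn; rewrite dn andbT ltnS.
  by rewrite (dvdn_leq n0 dn) andbT -subn1 subn_gt0; case: mip => -[].
(* If the cofactor of [Q] in [f] were nonconstant, an irreducible factor [p] of it would also occur
   in [Q], and [p ^+ 2] would divide the separable [f]. *)
have sQ : (size Q).-1 = (q ^ n)%N.
  have [g fE] := dvdpP _ _ Qf.
  have g0 : g != 0 by apply: contraNneq f0 => g0; rewrite fE g0 mul0r.
  have Q0 : Q != 0 by apply: contraNneq f0 => Q0; rewrite fE Q0 mulr0.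
  have [g1 | g1] := ltnP 1 (size g); last first.
    have sg : size g = 1%N.
      by apply/eqP; rewrite eqn_leq g1 size_poly_gt0.
    have /eqP := congr1 (fun p : {poly F} => size p) fE.
    by rewrite size_mul // sg add1n sf /= => /eqP <-.
  have [p pg mip] := monic_irreducible_divisor g1.
  have pf : p %| f by rewrite fE dvdp_mulr.
  have dn := irreducible_dvdp_Xqn_dvdn mip pf.
  have pN : (size p <= N)%N.
    apply: leq_trans nN; have := dvdn_leq n0 dn; rewrite -ltnS prednK //.
    by rewrite size_poly_gt0; case: mip => /irredp_neq0.
  pose p' := NPoly (pN : p \is a poly_of_size N).
  have p'S : p' \in S by apply/SP.
  have pQ : p %| Q by rewrite /Q (bigD1 p') //= dvdp_mulr.
  have : p ^+ 2 %| f by rewrite fE expr2 dvdp_mul.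
  have p1 : size p != 1%N by case: mip => -[]; case: size => [|[]].
  by rewrite (separable_nosquare (separable_Xqn_sub n0) _ p1).
rewrite -sQ size_prod_npoly; last by move=> p /SP[[/irredp_neq0]].
(* Group the factors by degree; [inord] loses nothing because these degrees are at most [n]. *)
rewrite (partition_big (fun p : {poly_N F} => inord (size p).-1 : 'I_n.+1)
          (fun d => d %| n)%N) /=; last first.
  by move=> p /degS/andP[/andP[_ pn] dn]; rewrite inordK.
apply: leq_sum => d dn; rewrite mulnC -sum_nat_const.
rewrite big_mkcond [X in (_ <= X)%N]big_mkcond /=; apply: leq_sum => p _.
case: ifP => // /andP[pS /eqP dE].
have /andP[/andP[p0 pn] _] := degS _ pS.
have dE' : (size p).-1 = d by rewrite -dE inordK.
rewrite dE'; case: ifP => // /negbT /negP[]; apply/monic_irr_polysP; split.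
  by case/SP: pS.
by rewrite -dE' prednK // (leq_trans p0) ?leq_pred.
Qed.

(** Isolate the term [d = n]; each other term is at most [q ^ d]. *)
Lemma exp_card_le_monic_irr n : (n < N)%N ->
  (q ^ n <= n * #|mirr n| + 2 * q ^ n./2)%N.
Proof.
case: n => [|n] nN; first by rewrite expn0.
apply: leq_trans (exp_card_le_sum_monic_irr _) _; first by rewrite nN.
rewrite big_mkcond big_ord_recr /= dvdnn addnC leq_add2l.
apply: leq_trans (sum_dvdn_exp_le n.+1 q_gt1).
rewrite big_mkord [X in (_ <= X)%N]big_mkcond; apply: leq_sum => d _.
by case: ifP => // _; apply: card_monic_irr_le.
Qed.

(** Factoring out the leading coefficient is a bijection onto pairs of a nonzero scalar and a monic
    irreducible polynomial. *)
Lemma card_irr_polys n : #|irr_polys F N n| = (q.-1 * #|mirr n|)%N.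
Proof.
rewrite -(cardC1 (0 : F)) -[X in (X * _)%N]cardsE -cardsX.
set A := setX _ _.
rewrite -(@card_in_imset _ _ (fun cp : F * {poly_N F} => cp.1 *: cp.2) A).
  apply: eq_card => g; apply/idP/imsetP => [|[[c p]]].
    rewrite inE => /andP[/asboolP irr /eqP sg].
    have g0 := irredp_neq0 irr.
    have lg0 : lead_coef g != 0 by rewrite lead_coef_eq0.
    exists (lead_coef g, (lead_coef g)^-1 *: g) => /=; last first.
      by rewrite scalerA divff // scale1r.
    rewrite !inE /= lg0 /= size_scale ?invr_eq0 // sg eqxx andbT.
    rewrite monicE lead_coefZ mulVf // eqxx andbT.
    by apply/asboolP/irreducible_polyZ; rewrite ?invr_eq0.
  rewrite !inE /= => /and3P[c0 /andP[/asboolP irr /eqP sp] pm] ->.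
  rewrite /= size_scale // sp eqxx andbT.
  by apply/asboolP/irreducible_polyZ.
move=> [c p] [c' p']; rewrite !inE /= => /and3P[c0 _ pm] /and3P[c0' _ pm'] E.
have Ev : c *: (p : {poly F}) = c' *: (p' : {poly F}) by have := congr1 val E.
have cc : c = c'.
  have := congr1 lead_coef Ev; rewrite !lead_coefZ.
  by rewrite (monicP pm) (monicP pm') !mulr1.
rewrite -cc in Ev *; congr pair; apply/val_inj.
by rewrite -[LHS](scalerK c0) /= Ev scalerK.
Qed.
End Counting.

(** * Counting the polynomials with a given truncation *)

(** [trunL] counts in a type that depends on [f]; a common ambient type allows the sums over [f] and
    [g] to be exchanged. *)
Lemma card_npoly_widen (F : finFieldType) (k N : nat) (P : pred {poly F}) :
  (k <= N)%N ->
  #|[set g : {poly_k F} | P g]| =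
  #|[set g : {poly_N F} | P g && (size g <= k)%N]|.
Proof.
move=> kN; have sN (g : {poly_k F}) : (g : {poly F}) \is a poly_of_size N.
  exact: leq_trans (size_npoly g) kN.
rewrite -(@card_imset _ _ (fun g => NPoly (sN g))); last first.
  by move=> g h /(congr1 val) /= /val_inj.
apply: eq_card => g; rewrite inE; apply/imsetP/andP => [[h]|[Pg gk]].
  by rewrite inE => Ph -> /=; rewrite size_npoly.
exists (NPoly (gk : (g : {poly F}) \is a poly_of_size k)); rewrite ?inE //.
exact: val_inj.
Qed.

(** The map sending [c] to [g + B * c] enumerates the set: for [c != 0] the size is
    [k + size c > size g], so [c] ranges over sizes up to [N - k]. *)
Lemma card_congruent_npoly (F : finFieldType) (N k : nat) (B : {poly F})
    (g : {poly_N F}) : size B = k.+1 -> (size g <= k <= N)%N ->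
  #|[set f : {poly_N F} | (B %| (g : {poly F}) - (f : {poly F}))
      && (size g <= size f)%N]| = (#|F| ^ (N - k))%N.
Proof.
move=> sB /andP[gk kN]; rewrite -card_npoly.
have B0 : B != 0 by rewrite -size_poly_gt0 sB.
have sBc (c : {poly F}) : c != 0 -> size (B * c) = (k + size c)%N.
  by move=> c0; rewrite size_mul // sB addSn.
have sE (c : {poly F}) :
    c != 0 -> size ((g : {poly F}) + B * c) = (k + size c)%N.
  move=> c0; rewrite addrC size_polyDl sBc // (leq_ltn_trans gk) //.
  by rewrite -[X in (X < _)%N]addn0 ltn_add2l size_poly_gt0.
have sN (c : {poly_(N - k) F}) :
    (g : {poly F}) + B * (c : {poly F}) \is a poly_of_size N.
  rewrite qualifE /=; have [->|c0] := eqVneq (c : {poly F}) 0.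
    by rewrite mulr0 addr0 size_npoly.
  by rewrite sE // -leq_subRL // size_npoly.
rewrite -cardsT -(@card_imset _ _ (fun c => NPoly (sN c))); last first.
  by move=> c d /(congr1 val) /= /addrI /(mulfI B0) /val_inj.
apply: eq_card => f; rewrite inE; apply/andP/imsetP => [[Bf gf]|[c _ ->]] /=.
  have [c fE] := dvdpP _ _ Bf.
  have fE' : (f : {poly F}) = (g : {poly F}) + B * (- c).
    by rewrite mulrN mulrC -fE opprB addrC subrK.
  have cN : - c \is a poly_of_size (N - k).
    rewrite qualifE /=; have [->|c0] := eqVneq (- c) 0; first by rewrite size_poly0.
    by rewrite leq_subRL // -sE // -fE' size_npoly.
  by exists (NPoly cN) => //; apply: val_inj.
split; first by rewrite opprD addrA subrr sub0r -mulrN dvdp_mulr.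
have [->|c0] := eqVneq (c : {poly F}) 0; first by rewrite mulr0 addr0.
by rewrite sE // (leq_trans gk) ?leq_addr.
Qed.

(** Double counting: each irreducible [g] contributes the number of [f] that it truncates, which
    depends only on its degree. *)
Lemma sum_trunL (F : finFieldType) (b : {poly F}) (m l : nat) :
    (0 < m)%N -> size b = m.+1 ->
  (\sum_(f : {poly_(m * l) F}) trunL b f =
   \sum_(1 <= h < m * l)
     #|irr_polys F (m * l) h| * #|F| ^ (m * l - m * (h %/ m).+1))%N.
Proof.
move=> m0 sb; set N := (m * l)%N.
pose e (g : {poly F}) := ((size g).-1 %/ m).+1.
pose irr (g : {poly F}) := `[< irreducible_poly g >].
have tE (f : {poly_N F}) : trunL b f = (\sum_(g : {poly_N F} | irr g)
    ((b ^+ e g %| (g : {poly F}) - (f : {poly F}))%R && (size g <= size f)))%N.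
  rewrite /trunL sb /= (@card_npoly_widen F (size f) N (fun g =>
    irr g && (b ^+ e g %| g - (f : {poly F})))) ?size_npoly //.
  rewrite -sum1_card big_mkcond [RHS]big_mkcond; apply: eq_bigr => g _.
  by rewrite inE -andbA; case: (irr g) => //=; case: (_ && _).
rewrite (eq_bigr _ (fun f _ => tE f)) exchange_big /=.
have irr_size (g : {poly_N F}) : irr g -> (0 < (size g).-1 < N)%N.
  case/asboolP=> g1 _; rewrite -subn1 subn_gt0 g1 /= subn1.
  by rewrite (leq_trans _ (size_npoly g)) // prednK // ltnW.
(* The modulus [b ^+ e g] has degree [m * e g], at least [size g] and at most [N], as the preceding
   count requires. *)
rewrite (eq_bigr (fun g : {poly_N F} => #|F| ^ (N - m * e g))%N); last first.
  move=> g ig; have /andP[_ gN] := irr_size g ig.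
  have sg : size g = (size g).-1.+1.
    by rewrite prednK // ltnW //; case/asboolP: ig.
  have sB : size (b ^+ e g) = (m * e g).+1.
    have b0 : b != 0 by rewrite -size_poly_gt0 sb.
    have := size_exp b (e g); rewrite sb /= => <-.
    by rewrite prednK // size_poly_gt0 expf_neq0.
  rewrite -(card_congruent_npoly sB (g := g)); last first.
    apply/andP; split; first by rewrite {1}sg /e mulnC ltn_ceil.
    by rewrite leq_mul2l /e ltn_divLR // (mulnC l) gN orbT.
  rewrite -sum1_card [RHS]big_mkcond; apply: eq_bigr => f _.
  by rewrite inE; case: (_ && _).
(* Regroup by degree: [g] occurs exactly for [h = (size g).-1]. *)
rewrite [RHS](eq_bigr (fun h =>
  \sum_(g in irr_polys F N h) #|F| ^ (N - m * e g)))%N.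
  rewrite (exchange_big_dep (fun g : {poly_N F} => irr g)) /=; last first.
    by move=> h g _; rewrite inE => /andP[].
  apply: eq_bigr => g ig; have /andP[g0 gN] := irr_size g ig.
  rewrite (eq_bigl (fun h => h == (size g).-1)) => [|h].
    by rewrite big_nat1_eq g0 gN.
  rewrite inE [`[< _ >]]ig /= eq_sym; move: g0; case: (size g) => //= -[] //.
move=> h _; rewrite -sum_nat_const; apply: eq_bigr => g.
by rewrite inE /e => /andP[_ /eqP ->].
Qed.

(** * Elementary estimates for sums and logarithms *)

Lemma sum_exp_uphalf_le (R : realFieldType) (x : R) (n : nat) :
  0 <= x -> x <= 2^-1 -> \sum_(1 <= h < n) x ^+ uphalf h <= 4 * x.
Proof.
move=> x0 x2; case: n => [|n]; first by rewrite big_geq // mulr_ge0.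
(* Strengthened for induction: the added term dominates the tail. An odd [h] and the next even one
   share an exponent, so its coefficient is 4 if both are still to come, 3 if only one is. *)
suff H : \sum_(1 <= h < n.+1) x ^+ uphalf h +
    (3 + (odd n.+1)%:R) * x ^+ uphalf n.+1 <= 4 * x.
  by apply: le_trans H; rewrite lerDl mulr_ge0 ?exprn_ge0 ?addr_ge0.
elim: n => [|n IHn]; first by rewrite big_geq //= expr1; lra.
apply: le_trans IHn; rewrite big_nat_recr //= -addrA lerD2l.
have y0 : 0 <= x ^+ (uphalf n.+1) by rewrite exprn_ge0.
have yx : x * x ^+ (uphalf n.+1) <= 2^-1 * x ^+ (uphalf n.+1) by rewrite ler_wpM2r.
move: y0 yx; rewrite /= uphalf_half; case: (odd n) => /=;
  rewrite ?add0n ?add1n ?exprS; lra.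
Qed.

(** Each induction step is [ln (1 + x) <= x] at [x = - 1 / (n + 2)]. *)
Lemma harmonic_le_ln (R : realType) (n : nat) : (0 < n)%N ->
  \sum_(1 <= h < n) (h%:R : R)^-1 <= 1 + ln n%:R.
Proof.
move=> n0; suff H : \sum_(1 <= h < n.+1) (h%:R : R)^-1 <= 1 + ln n%:R.
  by apply: le_trans H; rewrite big_nat_recr //= lerDl invr_ge0.
elim: n n0 => // -[_ _|n IHn _]; first by rewrite big_nat1 invr1 ln1 addr0.
rewrite big_nat_recr //=; have {IHn} := IHn isT.
have n1 : (0 : R) < n.+1%:R by rewrite ltr0n.
have n2 : (0 : R) < n.+2%:R by rewrite ltr0n.
suff : ln (n.+1%:R) - ln (n.+2%:R) <= - (n.+2%:R : R)^-1.
  set a := n.+2%:R^-1; set u := ln _; set v := ln _; set s := \sum_(_ <= _ < _) _.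
  by lra.
rewrite -ln_div ?posrE //.
have -> : (n.+1%:R / n.+2%:R : R) = 1 + (- n.+2%:R^-1).
  have -> : (n.+1%:R : R) = n.+2%:R - 1 by rewrite -[n.+2]addn1 natrD addrK.
  by rewrite mulrBl divff ?mul1r // gt_eqF.
by apply: le_ln1Dx; rewrite ltrN2 invf_lt1 // ltr1n.
Qed.

(** From [ln (1 / 2) <= - 1 / 2] follows [ln 4 = 2 * ln 2 >= 1]. It serves to absorb a constant into
    [ln N ^+ 2]. *)
Lemma ln_nat_ge1 (R : realType) (n : nat) : (4 <= n)%N -> 1 <= ln (n%:R : R).
Proof.
move=> n4; apply: (@le_trans _ _ (ln (4%:R : R))); last first.
  by rewrite ler_ln ?posrE ?ltr0n ?ler_nat //; lia.
have -> : (4%:R : R) = 2 * 2 by rewrite -natrM.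
rewrite lnM ?posrE //.
suff : ln (2^-1 : R) <= - 2^-1 by rewrite lnV ?posrE //; lra.
by have := @le_ln1Dx R (- 2^-1); rewrite (_ : 1 - 2^-1 = 2^-1 :> R); [apply|]; lra.
Qed.

(** * Density of the irreducible polynomials and the error term *)

Section Error.
Variables (R : realType) (F : finFieldType) (N : nat).
Let q : R := #|F|%:R.

Let q_ge2 : 2 <= q. Proof. by rewrite ler_nat finNzRing_gt1. Qed.
Let q_gt0 : 0 < q. Proof. exact: lt_le_trans q_ge2. Qed.

(** Divide the two counting bounds by [h * q ^ h]; the exponent comes from [h - h./2 = uphalf h]. *)
Lemma monic_irr_density h : (0 < h < N)%N ->
  `|#|monic_irr_polys F N h|%:R / q ^+ h - h%:R^-1|
    <= 2 * q^-1 ^+ uphalf h / h%:R.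
Proof.
case/andP=> h0 hN; set p : R := _%:R.
have hR : (0 : R) < h%:R by rewrite ltr0n.
have qh : 0 < q ^+ h by rewrite exprn_gt0.
have up : h%:R * p <= q ^+ h.
  by rewrite -natrX -natrM ler_nat card_monic_irr_le.
have lo : q ^+ h <= h%:R * p + 2 * q ^+ h./2.
  rewrite -!natrX -!natrM -natrD ler_nat; exact: exp_card_le_monic_irr.
have -> : q^-1 ^+ uphalf h = q ^+ h./2 / q ^+ h.
  rewrite exprVn -[X in _ / q ^+ X]odd_double_half -addnn addnA -uphalf_half exprD.
  by rewrite invfM mulrCA divff ?mulr1 // expf_neq0 // gt_eqF.
have -> : p / q ^+ h - h%:R^-1 = - ((q ^+ h - h%:R * p) / (q ^+ h * h%:R)).
  by field; rewrite ?pnatr_eq0 -?lt0n ?h0 // gt_eqF.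
have -> : 2 * (q ^+ h./2 / q ^+ h) / h%:R = (2 * q ^+ h./2) / (q ^+ h * h%:R).
  by rewrite invfM !mulrA.
rewrite normrN ger0_norm; last by rewrite divr_ge0 ?subr_ge0 // mulr_ge0 // ltW.
by rewrite ler_pM2r ?invr_gt0 ?mulr_gt0 // lerBlDl.
Qed.

End Error.

Theorem theorem4p1 (R : realType) :
  exists (C : R) (q0 l0 m0 : nat), 0 < C /\
    forall (F : finFieldType) (b : {poly F}) (m l : nat),
      (1 <= m)%N -> size b = m.+1 -> (1 <= l)%N ->
      let q : R := #|F|%:R in
      exists E : R,
        [/\ (q ^+ (m * l))^-1 *
              \sum_(f : {poly_(m * l) F}) (trunL b f)%:R
            = (q - 1) * \sum_(1 <= t < m.+1) (q ^- t *
                \sum_(1 <= h < m * l | (m %| h + t)%N) (h%:R)^-1) + E,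
            (q0 <= #|F|)%N \/ (l0 <= l)%N -> `|E| <= C * (1 / q) &
            (m0 <= m)%N ->
              `|E| <= C * (q * ln ((m * l)%:R) ^+ 2 / q `^ (m%:R / 2))].
Proof.
(* 8 is the 2 of the density bound times 4, where 4 comes from the geometric sum in the first
   estimate and from [1 + ln N <= 4 * ln N ^+ 2] in the second. The latter uses [ln N >= 1], whence
   [4 <= m]. *)
exists 8, 0%N, 0%N, 4%N; split=> // F b m l m0 sb l0 q.
set N := (m * l)%N.
have q2 : 2 <= q by rewrite ler_nat finNzRing_gt1.
have q0 : 0 < q by apply: lt_le_trans q2.
have qn0 : q != 0 by rewrite gt_eqF.
(* The distance from [h] to the next larger multiple of [m]: the unique [t] in [1..m] with [h]
   congruent to [-t]. *)
pose t h := (m * (h %/ m).+1 - h)%N.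
have tE h : (h + t h = m * (h %/ m).+1)%N.
  by rewrite subnKC // mulnC ltnW // ltn_ceil.
have t_gt0 h : (0 < t h)%N by rewrite subn_gt0 mulnC ltn_ceil.
have t_le h : (t h < m.+1)%N.
  by rewrite ltnS leq_subLR {2}(divn_eq h m) mulnS; lia.
pose p h : R := #|monic_irr_polys F N h|%:R.
have mainE : \sum_(1 <= t < m.+1) (q ^- t *
      \sum_(1 <= h < N | (m %| h + t)%N) (h%:R)^-1) =
    \sum_(1 <= h < N) q ^- t h * h%:R^-1.
  rewrite (eq_bigr (fun t => \sum_(1 <= h < N | (m %| h + t)%N) q ^- t * h%:R^-1));
    last by move=> s _; rewrite mulr_sumr.
  rewrite (exchange_big_dep xpredT) //=; apply: eq_bigr => h _.
  rewrite big_nat_cond (eq_bigl (fun s => (1 <= s < m.+1)%N && (s == t h))).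
    by rewrite -big_nat_cond big_nat1_eq t_gt0 t_le.
  move=> s; case: (boolP (1 <= s < m.+1)%N) => //= /andP[s0 sm].
  apply/idP/eqP => [|->]; last by rewrite tE dvdn_mulr.
  (* [h + s = k * m] with [1 <= s <= m] determines [k], hence [s = t h]. *)
  case/dvdnP=> k kE; have kh : (k = (h %/ m).+1)%N.
    by have := divn_eq h m; have := ltn_pmod h m0; nia.
  by rewrite /t -kh mulnC -kE addKn.
have LHSE : (q ^+ N)^-1 * \sum_(f : {poly_N F}) (trunL b f)%:R =
    (q - 1) * \sum_(1 <= h < N) q ^- t h * (p h / q ^+ h).
  rewrite -natr_sum (sum_trunL _ m0 sb) natr_sum !mulr_sumr.
  apply: eq_big_nat => h /andP[_ hN].
  have MN : (m * (h %/ m).+1 <= N)%N by rewrite leq_mul2l ltn_divLR // mulnC hN orbT.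
  rewrite card_irr_polys !natrM natrX -/q -/N.
  have -> : (#|F|.-1)%:R = q - 1 :> R.
    by rewrite -subn1 natrB // ltnW // finNzRing_gt1.
  (* [m * (h %/ m).+1 = h + t h] splits the weight into [q ^- t h] and [q ^- h]. *)
  rewrite -/(p h) exprB // ?unitfE // -tE exprD.
  by field; rewrite !expf_neq0.
pose E := (q - 1) * \sum_(1 <= h < N) q ^- t h * (p h / q ^+ h - h%:R^-1).
exists E.
have Ele : `|E| <= \sum_(1 <= h < N)
    (q - 1) * (q ^- t h * (2 * q^-1 ^+ uphalf h / h%:R)).
  rewrite /E mulr_sumr; apply: le_trans (ler_norm_sum _ _ _) _.
  rewrite big_nat [X in _ <= X]big_nat; apply: ler_sum => h hN.
  rewrite normrM ger0_norm ?ler_wpM2l //; try lra.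
  rewrite normrM ger0_norm ?invr_ge0 ?exprn_ge0 ?(ltW q0) //.
  by rewrite ler_wpM2l ?invr_ge0 ?exprn_ge0 ?(ltW q0) // monic_irr_density.
split.
- rewrite LHSE mainE -mulrDr -big_split /=; congr (_ * _).
  by apply: eq_bigr => h _; rewrite -mulrDr addrC subrK.
- move=> _; apply: le_trans Ele _.
  (* Since [t h >= 1], [q ^- t h] absorbs [q - 1]; bounding [1 / h] by 1 leaves a sum of at most
     [4 / q]. *)
  apply: (@le_trans _ _ (2 * \sum_(1 <= h < N) q^-1 ^+ uphalf h)); last first.
    have := @sum_exp_uphalf_le R q^-1 N; rewrite invr_ge0 (ltW q0).
    by rewrite lef_pV2 ?posrE // q2 div1r => /(_ isT isT); lra.
  rewrite mulr_sumr big_nat [X in _ <= X]big_nat; apply: ler_sum => h /andP[h0 hN].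
  have y0 : 0 <= q^-1 ^+ uphalf h by rewrite exprn_ge0 // invr_ge0 ltW.
  have a1 : (q - 1) * q ^- t h <= 1.
    rewrite ler_pdivrMr ?exprn_gt0 // mul1r.
    apply: (@le_trans _ _ (q ^+ 1)); first by rewrite expr1; lra.
    by rewrite ler_eXn2l ?t_gt0 //; lra.
  have h1 : (h%:R^-1 : R) <= 1 by rewrite invf_le1 ?ltr0n // ler1n.
  rewrite (mulrA (q - 1)) -[X in _ <= X]mul1r; apply: ler_pM => //.
  - by rewrite mulr_ge0 ?invr_ge0 ?exprn_ge0 ?(ltW q0) //; lra.
  - by rewrite mulr_ge0 ?invr_ge0 // mulr_ge0.
  - by rewrite ler_piMr // mulr_ge0.
- move=> m4; apply: le_trans Ele _.
  have N4 : (4 <= N)%N by rewrite (leq_trans m4) // leq_pmulr.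
  have ln1 := ln_nat_ge1 R N4.
  set Q := q `^ _; have Q0 : 0 < Q by rewrite powR_gt0.
  (* Now [1 / h] is kept and the powers of [q] are bounded by [q / Q], leaving a harmonic sum. *)
  apply: (@le_trans _ _ ((q * Q^-1 * 2) * \sum_(1 <= h < N) h%:R^-1)); last first.
    have := @harmonic_le_ln R N (leq_trans _ N4) => /(_ isT).
    move: (\sum_(1 <= h < N) _) ln1 => H; set L := ln _ => L1 HL.
    have -> : 8 * (q * L ^+ 2 / Q) = (q * Q^-1 * 2) * (4 * L ^+ 2) by ring.
    by apply: ler_wpM2l; [rewrite !mulr_ge0 // ?invr_ge0 ltW | nra].
  rewrite mulr_sumr big_nat [X in _ <= X]big_nat; apply: ler_sum => h /andP[h0 hN].
  rewrite !mulrA ler_wpM2r ?invr_ge0 //.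
  have -> : (q - 1) / q ^+ t h * 2 * q^-1 ^+ uphalf h =
      (q - 1) * (q ^+ (t h + uphalf h))^-1 * 2.
    by rewrite exprD invfM exprVn; ring.
  rewrite ler_pM2r //; apply: ler_pM; rewrite ?invr_ge0 ?exprn_ge0 ?(ltW q0) //; try lra.
  rewrite lef_pV2 ?posrE ?exprn_gt0 // -powR_mulrn ?(ltW q0) //.
  apply: ler_powR; first lra.
  (* [m <= m * (h %/ m).+1 = h + t h], and [h <= 2 * uphalf h]. *)
  rewrite ler_pdivrMr // -natrM ler_nat.
  have := tE h; have := uphalf_half h; have := odd_double_half h.
  by have := leq_pmulr m (ltn0Sn (h %/ m)); lia.
Qed.
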